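(* Any countable collection $\mathcal C=\{L_0,L_1,\dots\}$ of languages can be non-uniformly identified with feedback.
   Context: A language is an infinite subset of a countably infinite universe $U$; the collection is given with an explicit indexing $L_0,L_1,\dots$. An enumeration of $K$ is an infinite sequence $x_0,x_1,\dots$ of pairwise distinct elements of $K$ containing every element of $K$. An identifier algorithm with feedback is a function $G$: at each time $t$ the adversary reveals $x_t$, the algorithm asks a membership query $y_t=G(x_0,a_0,\dots,a_{t-1},x_t)\in U$, receives $a_t\in\{\mathrm{Yes},\mathrm{No}\}$ indicating whether $y_t\in K$, and outputs an index $z_t=G(x_0,a_0,\dots,x_t,a_t)\in\mathbb N$. $G$ non-uniformly identifies with feedback for $\mathcal C$ if for every $K\in\mathcal C$ there exists $t^\star$ such that for every enumeration of $K$, $L_{z_t}=K$ for all $t\ge t^\star$. *)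

(* Defs.v *)
From mathcomp Require Import all_boot.
From mathcomp Require Import all_classical.

Set Implicit Arguments.
Unset Strict Implicit.
Unset Printing Implicit Defensive.

Local Open Scope classical_set_scope.

Definition enumeration (U : Type) (K : set U) (x : nat -> U) : Prop :=
  injective x /\ range x = K.

(* The single function G of the paper is split according to the parity of the
   length of its argument: [query G [:: (x_0, a_0); ...; (x_(t-1), a_(t-1))] x_t]
   is the query y_t, and [guess G [:: (x_0, a_0); ...; (x_t, a_t)]] is the
   index z_t.  Neither component is required to be computable. *)
Record identifier (U : Type) := Identifier {
  query : seq (U * bool) -> U -> U;
  guess : seq (U * bool) -> nat
}.

(* [transcript G K x t] = [:: (x_0, a_0); ...; (x_(t-1), a_(t-1))]: the first t
   rounds when the target is K; the answers are true for Yes, false for No. *)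
Fixpoint transcript (U : Type) (G : identifier U) (K : set U) (x : nat -> U)
    (t : nat) : seq (U * bool) :=
  if t is s.+1 then
    let h := transcript G K x s in rcons h (x s, query G h (x s) \in K)
  else [::].

Definition output (U : Type) (G : identifier U) (K : set U) (x : nat -> U)
    (t : nat) : nat :=
  guess G (transcript G K x t.+1).

(* The collection is [range L]; t0 may depend on K but not on x. *)
Definition nonuniformly_identifies (U : Type) (L : nat -> set U)
    (G : identifier U) : Prop :=
  forall K : set U, range L K ->
  exists t0 : nat, forall x : nat -> U, enumeration K x ->
  forall t : nat, t0 <= t -> L (output G K x t) = K.

(* Main.v *)
Require Import Defs.
From mathcomp Require Import all_boot.
From mathcomp Require Import all_classical.

Local Open Scope classical_set_scope.
Local Open Scope card_scope.

(** Fix an enumeration [e] of the universe.  The identifier ignores the revealed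
    elements, queries [e 0, e 1, ...] in turn, and outputs the least index whose
    language agrees with all the answers received so far.  If [i] is the least
    index of [K], each of the finitely many earlier languages differs from [K]
    at some [e k], and the time by which all these points have been queried
    depends on [K] only. *)

Section LeastConsistentIndex.

Set Implicit Arguments.

Variables (U : Type) (e : nat -> U) (L : nat -> set U).

(** Position [k] of [h] is compared with [e k] because the query of round [k] is [e k]. *)
Definition consistent (h : seq (U * bool)) (i : nat) : bool :=
  unzip2 h == mkseq (fun k => e k \in L i) (size h).

(** The default [0] never arises on a transcript of [least_consistent_identifier] whose target is
    some [L i]: such an [i] is consistent with it. *)
Definition least_consistent (h : seq (U * bool)) : nat :=
  if pselect (exists i, consistent h i) is left ex_i then ex_minn ex_i else 0.

Definition least_consistent_identifier : identifier U :=
  Identifier (fun h _ => e (size h)) least_consistent.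

Lemma size_transcript (G : identifier U) (K : set U) (x : nat -> U) (t : nat) :
  size (transcript G K x t) = t.
Proof. by elim: t => //= t IHt; rewrite size_rcons IHt. Qed.

(** The history before round [t] has size [t], so the query is [e t] whatever [x] is. This is what
    makes the final time bound uniform in [x]. *)
Lemma unzip2_transcript (K : set U) (x : nat -> U) (t : nat) :
  unzip2 (transcript least_consistent_identifier K x t) =
  mkseq (fun k => e k \in K) t.
Proof.
elim: t => // t IHt.
by rewrite /= /unzip2 map_rcons [map _ _]IHt /= size_transcript mkseqS.
Qed.

Lemma consistent_transcriptP (K : set U) (x : nat -> U) (t i : nat) :
  reflect (forall k, k < t -> (e k \in L i) = (e k \in K))
    (consistent (transcript least_consistent_identifier K x t) i).
Proof.
rewrite /consistent unzip2_transcript size_transcript.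
apply: (iffP eqP) => [eq_ans k lt_kt | agree].
  by move/(congr1 (fun s => nth false s k)): eq_ans; rewrite !nth_mkseq.
by apply/eq_in_map => k; rewrite mem_iota => /agree ->.
Qed.

Lemma least_consistentE (h : seq (U * bool)) (i : nat) :
  consistent h i -> (forall j, j < i -> ~~ consistent h j) ->
  least_consistent h = i.
Proof.
move=> h_i h_lt; rewrite /least_consistent; case: pselect => [ex_i|[]]; last by exists i.
case: ex_minnP => m h_m m_min; apply/eqP; rewrite eqn_leq m_min //= leqNgt.
by apply/negP => /h_lt/negP.
Qed.

Hypothesis e_surj : forall u, exists k, e k = u.

Lemma exists_separating_index (A B : set U) :
  A <> B -> exists k, (e k \in A) <> (e k \in B).
Proof.
move=> neqAB; apply: contrapT => sepN; apply: neqAB; apply/seteqP.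
have eq_in u : (u \in A) = (u \in B).
  by have [k <-] := e_surj u; apply: contrapT => ne; apply: sepN; exists k.
by split=> u /mem_set; [rewrite eq_in | rewrite -eq_in] => /set_mem.
Qed.

Lemma exists_separating_time (K : set U) (n : nat) :
  (forall j, j < n -> L j <> K) ->
  exists t, forall j, j < n ->
    exists2 k, k < t & (e k \in L j) <> (e k \in K).
Proof.
elim: n => [|n IHn] neqK; first by exists 0.
have [t sep_t] := IHn (fun j lt_jn => neqK j (ltnW lt_jn)).
have [k sep_k] := exists_separating_index (neqK n (ltnSn n)).
(* [k.+1] rounds are needed for [e k] itself to be queried; [t] handles the indices below [n]. *)
exists (maxn t k.+1) => j; rewrite ltnS leq_eqVlt => /predU1P[->|/sep_t[l lt_lt sep_l]].
  by exists k => //; rewrite leq_maxr.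
by exists l => //; rewrite leq_max lt_lt.
Qed.

Lemma least_consistent_identifies :
  nonuniformly_identifies L least_consistent_identifier.
Proof.
move=> K [i0 _ L_i0].
have exK : exists i, `[< L i = K >] by exists i0; apply/asboolP.
(* [K] may occur several times in the collection; with its least index [i], every earlier language
   differs from [K]. *)
case: (ex_minnP exK) => i /asboolP L_i i_min {exK i0 L_i0}.
have [|t0 sep] := @exists_separating_time K i.
  by move=> j lt_ji L_j; have := i_min j (asboolT L_j); rewrite leqNgt lt_ji.
exists t0 => x _ t le_t0t; rewrite /output [guess _ _](@least_consistentE _ i) //.
  by apply/consistent_transcriptP => k _; rewrite L_i.
move=> j /sep[k lt_kt0 neq_k].
apply/negP => /consistent_transcriptP/(_ k) agree.
(* The guess at time [t] sees [t.+1] answers, among them the one about [e k], since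
   [k < t0 <= t]. *)
by apply: neq_k; apply: agree; rewrite ltnS (leq_trans (ltnW lt_kt0)).
Qed.

End LeastConsistentIndex.

Theorem theorem6p4 (U : Type) (U_countably_infinite : [set: U] #= [set: nat])
    (L : nat -> set U) (L_language : forall i : nat, infinite_set (L i)) :
  exists G : identifier U, nonuniformly_identifies L G.
Proof.
have [f] := card_set_bijP U_countably_infinite.
(* The inverse [e] of the bijection [f] enumerates [U]: [fK] says that [f u] is an index of [u]. *)
rewrite setTT_bijective => -[e fK _].
exists (least_consistent_identifier e L); apply: least_consistent_identifies => u.
by exists (f u).
Qed.
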